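(* (i) Let $-\infty\leqslant a<b\leqslant\infty$. If $f(s)$ is a function on $(a,b)$ satisfying Condition $(A)$, then the $\tau$-measure $\tau$ of $f$ satisfies Condition $(B)$. (ii) If $\tau$ is a measure on $\mathbb{R}$ satisfying Condition $(B)$, then there are an interval $(a,b)$ with $-\infty\leqslant a<b\leqslant\infty$ and a function $f(s)$ on $(a,b)$ satisfying Condition $(A)$ such that $\tau$ is the $\tau$-measure of $f$.
   Context: Functions are $\mathbb{R}$-valued; measures on $\mathbb{R}$ are Borel measures. ''Decreasing'' is in the wide sense (flatness allowed). The $\tau$-measure of a measurable $f\colon(a,b)\to\mathbb{R}$ is the measure $\tau$ on $\mathbb{R}$ given by $\tau(B)=\int_a^b1_{\{f(s)\in B\}}ds$ for Borel $B\subset\mathbb{R}$. Condition $(A)$ for a function $f$ on $(a,b)$: $f$ is decreasing, left-continuous, not constant, and $\inf_{t\in(a,b)}f(t)<f(s)<\sup_{t\in(a,b)}f(t)$ for all $s\in(a,b)$. Condition $(B)$ for a measure $\tau$ on $\mathbb{R}$: $\tau$ is not identically zero and, with $a'=\inf\mathrm{Supp}(\tau)$ and $b'=\sup\mathrm{Supp}(\tau)$ (in $[-\infty,\infty]$): $a'<b'$; $\tau((p,q))<\infty$ whenever $a'<p<q<b'$; either $a'=-\infty$, or $a'>-\infty$ and $\tau(\{a'\})=0$; either $b'=\infty$, or $b'<\infty$ and $\tau(\{b'\})=0$. *)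

(* Defs.v *)
From HB Require Import structures.
From mathcomp Require Import all_boot all_order all_algebra.
From mathcomp Require Import all_classical all_reals all_analysis.
From mathcomp Require Import measurable_realfun.

Set Implicit Arguments.
Unset Strict Implicit.
Unset Printing Implicit Defensive.

Import Order.TTheory GRing.Theory Num.Theory.
Import numFieldNormedType.Exports.

Local Open Scope classical_set_scope.
Local Open Scope ring_scope.
Local Open Scope ereal_scope.

(* A real function on (a, b), with a and b possibly infinite, is encoded as a
   total function R -> R; no definition below depends on its values outside
   of [eoo a b]. *)
Definition eoo (R : realType) (a b : \bar R) : set R :=
  [set s | a < s%:E < b].

Lemma measurable_eoo (R : realType) (a b : \bar R) : measurable (eoo a b).
Proof.
have -> : eoo a b = setT `&` EFin @^-1` [set` `]a, b[%O].
  by rewrite setTI; apply/seteqP; split=> s /=; rewrite in_itv.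
apply: EFin_measurable => //; exact: emeasurable_itv.
Qed.

Definition condition_A (R : realType) (a b : \bar R) (f : R -> R) : Prop :=
  let D := eoo a b in
  [/\ {in D &, {homo f : x y / (x <= y)%R >-> (y <= x)%R}},
      (forall s, D s -> f x @[x --> s^'-] --> f s),
      ~ (exists c : R, forall s, D s -> f s = c)
    & forall s, D s ->
        ereal_inf [set (f t)%:E | t in D] < (f s)%:E
        < ereal_sup [set (f t)%:E | t in D]].

Section tau_measure.
Context (R : realType) (a b : \bar R) (f : R -> R).

(* The measurability proof is not used in the formula; it is an argument so
   that [tau_measure mf] can be given its structure of measure. *)
Definition tau_measure (mf : measurable_fun (eoo a b) f) (B : set R) : \bar R :=
  \int[lebesgue_measure]_(s in eoo a b) (\1_B (f s))%:E.

Variable mf : measurable_fun (eoo a b) f.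

Lemma tau_measureE (B : set R) : measurable B ->
  tau_measure mf B = lebesgue_measure (eoo a b `&` f @^-1` B).
Proof.
move=> mB; have mD := @measurable_eoo R a b.
have mDB : measurable (eoo a b `&` f @^-1` B) by exact: mf.
rewrite /tau_measure.
transitivity (\int[@lebesgue_measure R]_(s in eoo a b)
    (\1_(eoo a b `&` f @^-1` B) s)%:E).
  apply: eq_integral => s /set_mem Ds; rewrite !indicE; congr (_%:R%:E).
  by congr nat_of_bool; apply/idP/idP => /set_mem H; apply/mem_set => //; case: H.
by rewrite integral_indic// setIAC setIid.
Qed.

Let tau_measure0 : tau_measure mf set0 = 0.
Proof. by rewrite tau_measureE// preimage_set0 setI0 measure0. Qed.

Let tau_measure_ge0 B : 0 <= tau_measure mf B.
Proof. by apply: integral_ge0 => s _; rewrite lee_fin. Qed.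

Let tau_measure_sigma_additive : semi_sigma_additive (tau_measure mf).
Proof.
move=> F mF tF mUF; rewrite tau_measureE// preimage_bigcup setI_bigcupr.
under eq_fun do under eq_bigr do rewrite tau_measureE//.
have mDF n : measurable (eoo a b `&` f @^-1` F n).
  by apply: mf; [exact: measurable_eoo|].
apply: measure_semi_sigma_additive => //; last exact: bigcupT_measurable.
apply/trivIsetP => i j _ _ ij; rewrite setIACA setIid -preimage_setI.
by move/trivIsetP : tF => ->//; rewrite preimage_set0 setI0.
Qed.

HB.instance Definition _ := isMeasure.Build _ _ _ (tau_measure mf)
  tau_measure0 tau_measure_ge0 tau_measure_sigma_additive.

End tau_measure.

Definition msupport (R : realType) (tau : {measure set R -> \bar R}) : set R :=
  [set x | forall U : set R, open U -> U x -> 0 < tau U].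

(* The points x with x%:E = e form the singleton of e if e is finite, and the
   empty set otherwise. *)
Definition condition_B (R : realType) (tau : {measure set R -> \bar R}) : Prop :=
  let a' := ereal_inf (EFin @` msupport tau) in
  let b' := ereal_sup (EFin @` msupport tau) in
  [/\ ~ (forall B : set R, measurable B -> tau B = 0),
      a' < b',
      (forall p q : R, a' < p%:E -> (p < q)%R -> q%:E < b' ->
         tau `]p, q[%classic < +oo),
      a' = -oo \/ (-oo < a' /\ tau [set x | x%:E = a'] = 0)
    & b' = +oo \/ (b' < +oo /\ tau [set x | x%:E = b'] = 0)].

(* Main.v *)
Require Import Defs.
From mathcomp Require Import all_boot all_order all_algebra.
From mathcomp Require Import all_classical all_reals all_analysis.
From mathcomp Require Import measurable_realfun lra.

(** A decreasing function and the measure of its values determine each other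
    in the way a quantile function and a distribution do.

    From [f] to [tau]: left-continuity makes [f] stay near [f s] on a
    nondegenerate interval ending at [s], so every value of [f] is in the
    support of [tau]; conversely the support lies in the closure of the range.
    Hence the endpoints of the support are the infimum and the supremum of [f].
    They are not attained, so they carry no mass, and a level set
    [p < f < q] strictly between them is trapped between two points of the
    domain, so it has finite length ([condition_A_condition_B]).

    From [tau] to [f]: let [I] be the open interval spanned by the support.
    Finiteness of [tau] on compact subintervals gives a decreasing [H] on [I]
    with [tau [x, y) = H x - H y] ([exists_distribution]), and [H] is
    left-continuous because [tau [y, x)] vanishes as [y] increases to [x].
    The generalized inverse [f s = sup {x in I | s <= H x}] satisfies the
    Galois relation [x <= f s <-> s <= H x] on [D = (inf H, sup H)], from which
    everything follows: [f] is decreasing and left-continuous, and [f] lies in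
    [[p, q)] exactly on [(H q, H p]], whose length is [H p - H q].  Condition
    (B) enters a second time to show that [H] attains neither its infimum nor
    its supremum: the complement of the support is null
    ([negligible_msupportC]) and so are the endpoints, so there is mass
    arbitrarily close to both ends of [I], on their inner side.  This gives the
    strict inequalities of condition (A).  Two measures null outside [I] and
    agreeing, finitely, on the half-open subintervals of [I] are equal
    ([eq_measure_eoo]). *)

Set Implicit Arguments.
Unset Strict Implicit.
Unset Printing Implicit Defensive.

Import Order.TTheory GRing.Theory Num.Theory.
Import numFieldNormedType.Exports.

Local Open Scope classical_set_scope.
Local Open Scope ring_scope.
Local Open Scope ereal_scope.

(** * Open intervals with extended endpoints *)

Lemma ereal_between (R : realType) (u v : \bar R) :
  u < v -> exists x : R, eoo u v x.
Proof.
move: u v => [u||] [v||] // uv; rewrite /eoo /=.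
- by exists ((u + v) / 2)%R; rewrite !lte_fin !midf_lt.
- by exists (u + 1)%R; rewrite ltry lte_fin ltrDl ltr01.
- by exists (v - 1)%R; rewrite ltNyr lte_fin gtrBl ltr01.
- by exists 0%R; rewrite ltNyr ltry.
Qed.

Lemma eoo_interval (R : realType) (u v : \bar R) : is_interval (eoo u v).
Proof.
move=> x y /andP[ux _] /andP[_ yv] z /andP[xz zy].
by rewrite /eoo /= (lt_le_trans ux)//= (le_lt_trans _ yv) ?lee_fin.
Qed.

(** The interval on which left-continuity at [s] can be exploited. *)
Lemma eoo_left (R : realType) (u v : \bar R) (s : R) :
  eoo u v s -> exists2 r, (r < s)%R & `]r, s] `<=` eoo u v.
Proof.
move=> /andP[us sv]; have [r /andP[ur rs]] := ereal_between us.
exists r => [|t]; first by rewrite -lte_fin.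
rewrite /= in_itv/= => /andP[rt ts].
by rewrite /eoo /= (lt_trans ur) ?lte_fin//= (le_lt_trans _ sv) ?lee_fin.
Qed.

Lemma measurable_EFin_eq (R : realType) (u : \bar R) :
  measurable [set x : R | x%:E = u].
Proof.
have := @EFin_measurable R setT measurableT _ (emeasurable_set1 u).
by rewrite setTI.
Qed.

(** The preimage of a ray [[x, +oo)] is again an interval; monotonicity is asked
    on [D] only, as the values outside the domain are arbitrary. *)
Lemma nonincreasing_on_measurable (R : realType) (D : set R) (f : R -> R) :
  is_interval D -> {in D &, {homo f : x y / (x <= y)%R >-> (y <= x)%R}} ->
  measurable_fun D f.
Proof.
move=> Ditv fD.
apply: (measurability (@RGenCInfty.G R)).
  exact: RGenCInfty.measurableE.
move=> _ [_ [x ->] <-]; apply: is_interval_measurable.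
move=> s t [Ds fs] [Dt ft] r /andP[sr rt].
have Dr : D r by apply: (Ditv s t); rewrite ?sr.
split=> //; move: ft; rewrite /= !in_itv/= !andbT => /le_trans; apply.
by apply: fD => //; exact: mem_set.
Qed.

(** * The support of a measure *)

(** A point outside the support lies in a null open set, hence in a null ball
    with rational centre and radius; there are countably many such balls. *)
Lemma negligible_msupportC (R : realType) (tau : {measure set R -> \bar R}) :
  tau.-negligible (~` msupport tau).
Proof.
(* The value set0 on None makes F total along the enumeration unpickle. *)
pose F (o : option (rat * rat)) : set R :=
  if o is Some (c, r) then
    if tau (ball (ratr c : R) (ratr r)) == 0 then ball (ratr c : R) (ratr r)
    else set0
  else set0.
apply: (@negligibleS _ _ _ _ (\bigcup_n F (unpickle n))).
  move=> x; rewrite /msupport /=.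
  move=> /existsNP[U] /not_implyP[oU] /not_implyP[Ux].
  move=> /negP; rewrite -leNgt => tU.
  have [c [r [/set_mem xB BU]]] := open_subball_rat oU (mem_set Ux).
  exists (pickle (c, r)); [exact: I|rewrite pickleK /F ifT//].
  rewrite eq_le measure_ge0 andbT (le_trans _ tU)//.
  apply: le_measure => //; rewrite inE; first exact: measurable_ball.
  exact: open_measurable.
apply: negligible_bigcup => n.
case: (unpickle n) => [[c r]|] /=; last exact: negligible_set0.
case: eqP => [t0|_]; last exact: negligible_set0.
by apply/negligibleP => //; exact: measurable_ball.
Qed.

Lemma msupport_itv_gt0 (R : realType) (tau : {measure set R -> \bar R})
    (x y z : R) :
  msupport tau z -> (x < z)%R -> (z < y)%R -> 0 < tau `[x, y[%classic.
Proof.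
move=> sz xz zy; apply: (@lt_le_trans _ _ (tau `]x, y[%classic)).
  by apply: sz; [exact: itv_open|rewrite /= in_itv/= xz].
apply: le_measure; rewrite ?inE; [exact: measurable_itv..|].
by move=> t; rewrite /= !in_itv/= => /andP[/ltW -> ->].
Qed.

(** * The measure of the values of a decreasing function *)

Lemma condition_A_condition_B (R : realType) (a b : \bar R) (f : R -> R) :
  a < b -> condition_A a b f ->
  exists mf : measurable_fun (eoo a b) f, condition_B (tau_measure mf).
Proof.
move=> ab [fD fl _ fsup]; set D := eoo a b in fD fl fsup.
have mf : measurable_fun D f.
  by apply: nonincreasing_on_measurable => //; exact: eoo_interval.
exists mf.
(* A set has positive mass as soon as its preimage contains an interval. *)
have tau_gt0 B : measurable B -> forall r s : R, (r < s)%R ->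
    `]r, s] `<=` D `&` f @^-1` B -> 0 < tau_measure mf B.
  move=> mB r s rs sub; rewrite tau_measureE//.
  apply: (@lt_le_trans _ _ (lebesgue_measure `]r, s]%classic)).
    by rewrite lebesgue_measure_itv/= lte_fin rs -EFinB lte_fin subr_gt0.
  apply: le_measure => //; rewrite inE; first exact: measurable_itv.
  by apply: mf => //; exact: measurable_eoo.
have supp_f s : D s -> msupport (tau_measure mf) (f s).
  move=> Ds U oU Ufs.
  have [r rs rD] := eoo_left Ds.
  have [e /= e0 eU] : \forall t \near s^'-, U (f t).
    by apply: (fl _ Ds); exact: open_nbhs_nbhs.
  pose m := Num.max r (s - e)%R.
  apply: (tau_gt0 _ (open_measurable oU) m s).
    by rewrite /m gt_max rs gtrBl.
  move=> t; rewrite /= in_itv/= /m gt_max -andbA => /and3P[rt et ts].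
  split; first by apply: rD; rewrite /= in_itv/= rt.
  move: ts; rewrite le_eqVlt => /predU1P[->//|ts].
  by apply: eU => //=; rewrite gtr0_norm ?subr_gt0// ltrBlDr addrC -ltrBlDr.
set i := ereal_inf [set (f t)%:E | t in D] in fsup.
set j := ereal_sup [set (f t)%:E | t in D] in fsup.
have null_off V : open V -> V `&` f @` D = set0 -> tau_measure mf V = 0.
  move=> oV Vf; rewrite tau_measureE; last exact: open_measurable.
  have -> : D `&` f @^-1` V = set0; last exact: measure0.
  apply/seteqP; split=> // s [Ds Vs].
  by have : (V `&` f @` D) (f s) by []; rewrite Vf.
have supp_sub U x : open U -> U x -> msupport (tau_measure mf) x ->
    exists2 s, D s & U (f s).
  move=> oU Ux /(_ _ oU Ux); rewrite lt0e => /andP[/eqP tU _].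
  apply: contrapT => nU; apply: tU; apply: null_off => //.
  apply/seteqP; split=> // y [Uy [t Dt ty]].
  by apply: nU; exists t; rewrite ?ty.
have infE : ereal_inf (EFin @` msupport (tau_measure mf)) = i.
  apply/eqP; rewrite eq_le; apply/andP; split; apply/ereal_infP.
    move=> _ [t Dt <-]; apply: ereal_inf_lbound.
    by exists (f t) => //; exact: supp_f.
  move=> _ [x sx <-]; rewrite leNgt; apply/negP => xi.
  have [y /andP[xy yi]] := ereal_between xi.
  have [||s Ds] := supp_sub `]-oo, y[%classic x _ _ sx.
  - exact: lray_open.
  - by rewrite /= in_itv/= -lte_fin.
  rewrite /= in_itv/= -lte_fin => /lt_trans/(_ yi); rewrite ltNge.
  by rewrite ereal_inf_lbound//; exists s.
have supE : ereal_sup (EFin @` msupport (tau_measure mf)) = j.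
  apply/eqP; rewrite eq_le; apply/andP; split; apply/ereal_supP; last first.
    move=> _ [t Dt <-]; apply: ereal_sup_ubound.
    by exists (f t) => //; exact: supp_f.
  move=> _ [x sx <-]; rewrite leNgt; apply/negP => jx.
  have [y /andP[jy yx]] := ereal_between jx.
  have [||s Ds] := supp_sub `]y, +oo[%classic x _ _ sx.
  - exact: rray_open.
  - by rewrite /= in_itv/= andbT -lte_fin.
  rewrite /= in_itv/= andbT -lte_fin => /(lt_trans jy); rewrite ltNge.
  by rewrite ereal_sup_ubound//; exists s.
have [s0 Ds0] := ereal_between ab.
have /andP[ifs fsj] := fsup _ Ds0.
rewrite /condition_B infE supE; split.
- move=> /(_ _ measurableT) t0.
  have [r rs rD] := eoo_left Ds0.
  have : 0 < tau_measure mf setT.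
    by apply: (tau_gt0 _ measurableT _ _ rs) => t /rD.
  by rewrite t0 ?ltxx.
- exact: lt_trans fsj.
- move=> p q ip _ qj; rewrite /= tau_measureE; last exact: measurable_itv.
  have [_ [s Ds <-] fsp] := ereal_inf_lt ip.
  have [_ [t Dt <-] qft] := ereal_sup_gt qj.
  apply: (@le_lt_trans _ _ (lebesgue_measure `[t, s]%classic)).
    apply: le_measure; rewrite ?inE.
    + exact: (mf (measurable_eoo a b) _ (measurable_itv _)).
    + exact: measurable_itv.
    move=> r [Dr]; rewrite /= !in_itv/= => /andP[pr rq].
    rewrite !leNgt; apply/andP; split; apply/negP => /ltW.
    + move=> /(fD _ _ (mem_set Dr) (mem_set Dt)) ftr.
      by move: qft; rewrite lte_fin ltNge (le_trans ftr)// ltW.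
    + move=> /(fD _ _ (mem_set Ds) (mem_set Dr)) frs.
      by move: fsp; rewrite lte_fin ltNge (le_trans _ frs)// ltW.
  by rewrite lebesgue_measure_itv/=; case: ifP => // _; rewrite -EFinB ltry.
- case: (eqVneq i -oo) => [->|i0]; [by left|right].
  rewrite ltNye i0; split=> //.
  rewrite /= tau_measureE; last exact: measurable_EFin_eq.
  have -> : D `&` f @^-1` [set x | x%:E = i] = set0; last exact: measure0.
  by apply/seteqP; split=> // s [/fsup /andP[+ _] /= fi]; rewrite fi ltxx.
- case: (eqVneq j +oo) => [->|j0]; [by left|right].
  rewrite ltey j0; split=> //.
  rewrite /= tau_measureE; last exact: measurable_EFin_eq.
  have -> : D `&` f @^-1` [set x | x%:E = j] = set0; last exact: measure0.
  by apply/seteqP; split=> // s [/fsup /andP[_ +] /= fj]; rewrite fj ltxx.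
Qed.

(** * Equality of measures on an open interval *)

(** Restricted to [[p, q)] both measures are finite, so agreement on the
    pi-system of the rays [[x, +oo)], whose traces on [[p, q)] are half-open
    intervals with endpoint [q], is enough. *)
Lemma eq_measure_co (R : realType) (mu nu : {measure set R -> \bar R})
    (p q : R) :
  mu `[p, q[%classic < +oo ->
  (forall x y, (p <= x)%R -> (x <= y)%R -> (y <= q)%R ->
    mu `[x, y[%classic = nu `[x, y[%classic) ->
  forall A, measurable A ->
    mu (`[p, q[%classic `&` A) = nu (`[p, q[%classic `&` A).
Proof.
move=> mufin munu A mA.
have mpq : measurable (`[p, q[%classic : set R) by exact: measurable_itv.
have trace x :
    `[x, +oo[%classic `&` `[p, q[%classic = `[Num.max p x, q[%classic.
  apply/seteqP; split => z; rewrite /= !in_itv/= ?andbT.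
    by move=> [xz /andP[pz ->]]; rewrite ge_max pz xz.
  by rewrite ge_max => /andP[/andP[-> ->] ->].
rewrite ![`[p, q[%classic `&` A]setIC.
pose m1 : {measure set R -> \bar R} := mrestr mu mpq.
pose m2 : {measure set R -> \bar R} := mrestr nu mpq.
rewrite -[mu _]/(m1 A) -[nu _]/(m2 A).
move: A mA; apply: (measure_unique (@RGenCInfty.G R)
  (fun n => `[(- n%:R)%R, +oo[%classic)).
- exact: RGenCInfty.measurableE.
- move=> _ _ [x ->] [y ->]; exists (Num.max x y).
  apply/seteqP; split => z; rewrite /= !in_itv/= !andbT ge_max.
    by move=> [-> ->].
  by move=> /andP[].
- by move=> n; exists (- n%:R)%R.
- apply/seteqP; split => // z _; exists (Num.truncn `|z|).+1 => //=.
  rewrite in_itv/= andbT lerNl (le_trans (ler_norm _))// normrN ltW//.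
  exact: truncnS_gt.
- move=> _ [x ->]; rewrite /m1 /m2 /= /mrestr trace.
  have [mq|qm] := leP (Num.max p x) q.
    by apply: munu => //; rewrite le_max lexx.
  by rewrite set_itv_ge ?measure0// bnd_simp -leNgt ltW.
- move=> n; rewrite /m1 /m2 /= /mrestr (le_lt_trans _ mufin)//.
  by apply: le_measure; rewrite ?inE//; exact: measurableI.
Qed.

Lemma eq_measure_eoo (R : realType) (u v : \bar R)
    (mu nu : {measure set R -> \bar R}) :
  mu (~` eoo u v) = 0 -> nu (~` eoo u v) = 0 ->
  (forall x y, eoo u v x -> eoo u v y -> (x <= y)%R ->
    mu `[x, y[%classic < +oo /\ mu `[x, y[%classic = nu `[x, y[%classic) ->
  forall A, measurable A -> mu A = nu A.
Proof.
move=> mu0 nu0 munu A mA; set I := eoo u v in mu0 nu0 munu.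
have mI : measurable I by exact: measurable_eoo.
(* The rational half-open intervals inside I, together with the complement of
   I, form a countable cover; None at either level encodes the complement. *)
pose g (o : option (option (rat * rat))) : set R :=
  if o is Some (Some (p, q)) then
    if `[< [/\ I (ratr p), I (ratr q) & (ratr p <= ratr q :> R)%R] >]
    then `[ratr p, ratr q[%classic else set0
  else ~` I.
pose F n : set R := g (unpickle n).
have FK o : F (pickle o) = g (Some o) by rewrite /F pickleK.
have mg o : measurable (g o).
  case: o => [[[p q]|]|] /=; [|exact: measurableC..].
  by case: ifP => _ //; exact: measurable_itv.
have null_trace (m : {measure set R -> \bar R}) B :
    measurable B -> m (~` I) = 0 -> m (~` I `&` B) = 0.
  move=> mB mIC; apply/eqP; rewrite eq_le measure_ge0 andbT -mIC.
  apply: le_measure; rewrite ?inE; [|exact: measurableC|exact: subIsetl].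
  by apply: measurableI => //; exact: measurableC.
have sR : <<s @measurable _ R >> = @measurable _ R.
  by apply: sigma_algebra_id; exact: sigma_algebra_measurable.
apply: (@g_sigma_algebra_measure_unique_cover _ _ _ measurable _
  F) => //; last by rewrite sR.
- by move=> n; exact: mg.
- apply/seteqP; split=> // x _.
  have [Ix|nIx] := pselect (I x); last first.
    by exists (pickle (None : option (rat * rat))); [exact: Logic.I|rewrite FK].
  have /andP[ux xv] := Ix.
  have [l /andP[ul lx]] := ereal_between ux.
  have [r /andP[xr rv]] := ereal_between xv.
  have [p] := rat_in_itvoo lx; rewrite in_itv/= => /andP[lp px].
  have [q] := rat_in_itvoo xr; rewrite in_itv/= => /andP[xq qr].
  have pqI : [/\ I (ratr p), I (ratr q) & (ratr p <= ratr q :> R)%R].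
    split; last by rewrite ltW// (lt_trans px).
    + by rewrite /I /eoo /= (lt_trans ul) ?lte_fin//= (lt_trans _ xv) ?lte_fin.
    + by rewrite /I /eoo /= (lt_trans ux) ?lte_fin//= (lt_trans _ rv) ?lte_fin.
  exists (pickle (Some (p, q))); [exact: Logic.I|rewrite FK /g].
  by rewrite asboolT//= in_itv/= (ltW px).
- move=> n B; rewrite sR => mB; rewrite /F.
  case: (unpickle n) => [[[p q]|]|] /=.
  + case: asboolP => [[Ip Iq pq]|_]; last by rewrite !set0I !measure0.
    apply: eq_measure_co => //; first by have [] := munu _ _ Ip Iq pq.
    move=> x y px xy yq.
    have Ix : I x by apply: (eoo_interval Ip Iq); rewrite px (le_trans xy).
    have Iy : I y by apply: (eoo_interval Ip Iq); rewrite yq (le_trans px).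
    by have [] := munu _ _ Ix Iy xy.
  + by rewrite (null_trace mu)// (null_trace nu).
  + by rewrite (null_trace mu)// (null_trace nu).
Qed.

(** * Distribution functions *)

Lemma measure_co_cat (R : realType) (mu : {measure set R -> \bar R})
    (x y z : R) :
  (x <= y)%R -> (y <= z)%R ->
  mu `[x, z[%classic = mu `[x, y[%classic + mu `[y, z[%classic.
Proof.
move=> xy yz; rewrite -measureU//; last first.
  apply/seteqP; split=> // t; rewrite /= !in_itv/=.
  by move=> [/andP[_ ty] /andP[yt _]]; move: ty; rewrite ltNge yt.
congr (mu _); apply/seteqP; split=> t; rewrite /= !in_itv/=.
  by move=> /andP[xt tz]; case: (ltP t y) => ty; [left|right]; rewrite ?xt ?tz.
by move=> [|] /andP[]; [move=> -> /lt_le_trans ->|move=> /(le_trans xy) -> ->].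
Qed.

(** A measure on an open interval which need not be finite near either end still
    has a distribution function, determined up to a constant by the choice of a
    base point; here it is decreasing, to fit the mass of [[x, y)]. *)
Lemma exists_distribution (R : realType) (u v : \bar R)
    (mu : {measure set R -> \bar R}) :
  u < v ->
  (forall x y, eoo u v x -> eoo u v y -> mu `[x, y[%classic < +oo) ->
  exists H : R -> R, forall x y, eoo u v x -> eoo u v y -> (x <= y)%R ->
    mu `[x, y[%classic = (H x - H y)%:E.
Proof.
move=> /ereal_between[c Ic] mufin.
pose m x y := fine (mu `[x, y[%classic).
have mE x y : eoo u v x -> eoo u v y -> (m x y)%:E = mu `[x, y[%classic.
  by move=> Ix Iy; rewrite /m fineK// ge0_fin_numE// mufin.
have m_cat x y z : eoo u v x -> eoo u v y -> eoo u v z ->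
    (x <= y)%R -> (y <= z)%R -> m x z = (m x y + m y z)%R.
  move=> Ix Iy Iz xy yz; apply: EFin_inj.
  by rewrite EFinD !mE// -measure_co_cat.
have m0 x y : (y <= x)%R -> m x y = 0%R.
  by move=> yx; rewrite /m set_itv_ge ?measure0// bnd_simp -leNgt.
(* The signed mass between x and the base point c: one of the two terms is
   zero, according to the side of c on which x lies. *)
exists (fun x => m x c - m c x)%R => x y Ix Iy xy; rewrite -mE//; congr (_%:E).
have [cx|xc] := leP c x.
  by rewrite (m0 x c)// (m0 y c) ?(le_trans cx)// (m_cat c x y)//; lra.
have {}xc := ltW xc; rewrite (m0 c x)//.
have [cy|/ltW yc] := leP c y.
  by rewrite (m0 y c)// (m_cat x c y)//; lra.
by rewrite (m0 c y)// (m_cat x y c)//; lra.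
Qed.

(** Continuity from above along intervals shrinking to the empty set: this is
    what makes distribution functions of half-open intervals left-continuous. *)
Lemma measure_co_small (R : realType) (mu : {measure set R -> \bar R})
    (p x e : R) :
  (p < x)%R -> mu `[p, x[%classic < +oo -> (0 < e)%R ->
  exists2 y, (p <= y < x)%R & mu `[y, x[%classic < e%:E.
Proof.
move=> px mufin e0.
pose y (n : nat) := Num.max p (x - n.+1%:R^-1)%R.
have yx n : (y n < x)%R by rewrite /y gt_max px gtrBl invr_gt0 ltr0n.
have py n : (p <= y n)%R by rewrite /y le_max lexx.
have capE : \bigcap_n `[y n, x[%classic = set0.
  apply/seteqP; split=> // t Ft.
  have := Ft 0%N Logic.I; rewrite /= in_itv/= => /andP[_ tx].
  pose n := Num.truncn (x - t)^-1.
  have := Ft n Logic.I; rewrite /= in_itv/= tx andbT leNgt => /negP; apply.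
  rewrite /y lt_max.
  apply/orP; right; rewrite ltrBrDr addrC -ltrBrDr -[ltRHS]invrK.
  rewrite ltf_pV2 ?posrE ?invr_gt0 ?subr_gt0//; exact: truncnS_gt.
have : (mu \o (fun n => `[y n, x[%classic)) n @[n --> \oo] --> 0.
  rewrite -(measure0 mu) -capE; apply: nonincreasing_cvg_mu.
  - rewrite (le_lt_trans _ mufin)//; apply: le_measure; rewrite ?inE//.
    move=> t; rewrite /= !in_itv/= => /andP[+ ->].
    by rewrite andbT; exact: le_trans.
  - by move=> n; exact: measurable_itv.
  - by rewrite capE.
  - move=> m n mn; apply/subsetPset => t; rewrite /= !in_itv/= => /andP[+ ->].
    rewrite andbT; apply: le_trans; rewrite /y ge_max !le_max lexx/=.
    by rewrite lerB ?orbT// lef_pV2 ?posrE ?ltr0n// ler_nat.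
have e0' : (0 : \bar R) < e%:E by rewrite lte_fin.
move=> /(_ [set z | z < e%:E]) [|n _ /(_ n (leqnn n)) /= yn].
  by apply: open_nbhs_nbhs; split=> //; exact: open_ereal_lt_ereal.
by exists (y n); rewrite ?py ?yx.
Qed.

(** * Generalized inverse of a decreasing function *)

Section generalized_inverse.
Context (R : realType) (u v : \bar R) (H : R -> R).
Local Notation I := (eoo u v).
Hypothesis H_ni : forall x y, I x -> I y -> (x <= y)%R -> (H y <= H x)%R.
(** Left-continuity, in the one form needed for a decreasing function. *)
Hypothesis H_left : forall x s, I x ->
  (forall y, I y -> (y < x)%R -> (s <= H y)%R) -> (s <= H x)%R.
(** The next two say that [H] is not eventually constant at either end. *)
Hypothesis H_lt_right : forall x, I x ->
  exists y, [/\ I y, (x < y)%R & (H y < H x)%R].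
Hypothesis H_lt_left : forall y, I y ->
  exists x, [/\ I x, (x < y)%R & (H y < H x)%R].

Let a := ereal_inf [set (H x)%:E | x in I].
Let b := ereal_sup [set (H x)%:E | x in I].

Definition generalized_inverse (s : R) : R := sup [set x | I x /\ (s <= H x)%R].
Local Notation f := generalized_inverse.

(** The domain of the inverse is open, yet contains the range of [H], as [H]
    attains neither bound. *)
Lemma generalized_inverse_dom x : I x -> eoo a b (H x).
Proof.
move=> Ix; apply/andP; split.
  have [y [Iy _ yx]] := H_lt_right Ix.
  rewrite (@le_lt_trans _ _ (H y)%:E) ?lte_fin// ereal_inf_lbound//.
  by exists y.
have [y [Iy _ xy]] := H_lt_left Ix.
by rewrite (@lt_le_trans _ _ (H y)%:E) ?lte_fin// ereal_sup_ubound//; exists y.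
Qed.

(** The relation [s <= H x] passes to the supremum of the [x] satisfying it by
    left-continuity of [H], so that the supremum is attained. *)
Lemma generalized_inverse_galois s : eoo a b s ->
  I (f s) /\ forall x, I x -> (x <= f s)%R = (s <= H x)%R.
Proof.
move=> /andP[] /ereal_inf_lt[_ [q Iq <-]]; rewrite lte_fin => Hqs.
move=> /ereal_sup_gt[_ [p Ip <-]]; rewrite lte_fin => sHp.
have S_ub : ubound [set x | I x /\ (s <= H x)%R] q.
  move=> x [Ix sHx]; rewrite leNgt; apply/negP => /ltW qx.
  by move: Hqs; rewrite ltNge (le_trans sHx)// H_ni.
have S_p : [set x | I x /\ (s <= H x)%R] p by split=> //; exact: ltW.
have hub : has_ubound [set x | I x /\ (s <= H x)%R] by exists q.
have If : I (f s).
  apply: (eoo_interval Ip Iq); apply/andP; split; first exact: ub_le_sup.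
  by apply: ge_sup => //; exists p.
split=> // x Ix; apply/idP/idP => [xf|sHx]; last exact: ub_le_sup.
apply: H_left => // y Iy yx.
have [||z [Iz sHz] yz] := @sup_gt _ [set x | I x /\ (s <= H x)%R] y.
- by exists p.
- exact: lt_le_trans xf.
- by rewrite (le_trans sHz)// H_ni// ltW.
Qed.

Lemma generalized_inverse_ni :
  {in eoo a b &, {homo f : s t / (s <= t)%R >-> (t <= s)%R}}.
Proof.
move=> s t /set_mem Ds /set_mem Dt st.
have [_ fsE] := generalized_inverse_galois Ds.
have [It ftE] := generalized_inverse_galois Dt.
by rewrite fsE// (le_trans st)// -ftE.
Qed.

Lemma generalized_inverse_preimage p q : I p -> I q ->
  eoo a b `&` f @^-1` `[p, q[ = `]H q, H p]%classic.
Proof.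
move=> Ip Iq; apply/seteqP; split=> s; rewrite /= !in_itv/=.
  move=> [Ds]; have [_ fsE] := generalized_inverse_galois Ds.
  by rewrite fsE// (ltNge _ q) fsE// -ltNge andbC.
move=> /andP[Hqs sHp]; have Ds : eoo a b s.
  have /andP[aHq _] := generalized_inverse_dom Iq.
  have /andP[_ Hpb] := generalized_inverse_dom Ip.
  by rewrite /eoo /= (lt_trans aHq) ?lte_fin//= (le_lt_trans _ Hpb) ?lee_fin.
split=> //; have [_ fsE] := generalized_inverse_galois Ds.
by rewrite fsE// (ltNge _ q) fsE// -ltNge Hqs sHp.
Qed.

(** A value [y] between [f s] and [v] is exceeded by [f (H y)], which gives
    the strict bounds, and has [H y < s], so [f] stays below [y] on
    [(H y, s]], which gives left-continuity. *)
Lemma generalized_inverse_condition_A : u < v -> condition_A a b f.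
Proof.
move=> uv.
have strict s : eoo a b s -> ereal_inf [set (f t)%:E | t in eoo a b] < (f s)%:E
    < ereal_sup [set (f t)%:E | t in eoo a b].
  move=> /generalized_inverse_galois[If _]; apply/andP; split.
    have [x [Ix _ Hx]] := H_lt_left If.
    have Dx := generalized_inverse_dom Ix.
    apply: (@le_lt_trans _ _ (f (H x))%:E).
      by apply: ereal_inf_lbound; exists (H x).
    rewrite lte_fin ltNge.
    by have [_ ->] := generalized_inverse_galois Dx; rewrite // -ltNge.
  have /andP[_ /ereal_between[y /andP[fy yv]]] := If.
  have Iy : I y by have /andP[uf _] := If; rewrite /eoo /= yv (lt_trans uf).
  have Dy := generalized_inverse_dom Iy.
  apply: (@lt_le_trans _ _ (f (H y))%:E); last first.
    by apply: ereal_sup_ubound; exists (H y).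
  rewrite (lt_le_trans fy)// lee_fin.
  by have [_ ->] := generalized_inverse_galois Dy.
split=> //.
- exact: generalized_inverse_ni.
- move=> s Ds; have [If fsE] := generalized_inverse_galois Ds.
  apply/cvgrPdist_lt => e e0.
  have /andP[uf fv] := If.
  (* y is taken below v to stay in I, where the Galois relation holds. *)
  have : (f s)%:E < Order.min v (f s + e)%:E.
    by rewrite lt_min fv lte_fin ltrDl.
  move=> /ereal_between[y /andP[fy]]; rewrite lt_min => /andP[yv ye].
  have Iy : I y by rewrite /eoo /= yv (lt_trans uf).
  have Hys : (H y < s)%R by rewrite ltNge -fsE// -ltNge -lte_fin.
  near=> t.
  have ts : (t < s)%R by near: t; exact: nbhs_left_lt.
  have Ht : (H y < t)%R by near: t; exact: nbhs_left_gt.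
  have Dt : eoo a b t.
    have /andP[aH _] := generalized_inverse_dom Iy.
    have /andP[_ sb] := Ds.
    by rewrite /eoo /= (lt_trans aH) ?lte_fin//= (lt_trans _ sb) ?lte_fin.
  have [_ ftE] := generalized_inverse_galois Dt.
  have fst : (f s <= f t)%R.
    by apply: generalized_inverse_ni; rewrite ?inE// ltW.
  have fty : (f t < y)%R by rewrite ltNge ftE// -ltNge.
  rewrite distrC ger0_norm ?subr_ge0// ltrBlDl (lt_trans fty)//.
- move=> [c fc]; have [x Ix] := ereal_between uv.
  have Dx := generalized_inverse_dom Ix.
  have /andP[_ /ereal_sup_gt[_ [t Dt <-]]] := strict _ Dx.
  by rewrite !fc// ltxx.
Unshelve. all: by end_near. Qed.

End generalized_inverse.

(** * Recovering the function from the measure *)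

Lemma condition_B_condition_A (R : realType) (tau : {measure set R -> \bar R}) :
  condition_B tau ->
  exists (a b : \bar R) (f : R -> R),
    [/\ a < b, condition_A a b f
      & exists mf : measurable_fun (eoo a b) f,
          forall B : set R, measurable B -> tau B = tau_measure mf B].
Proof.
move=> [_]; set u := ereal_inf _; set v := ereal_sup _ => uv tfin tu tv.
pose I := eoo u v.
have supp_u z : msupport tau z -> u <= z%:E.
  by move=> sz; apply: ereal_inf_lbound; exists z.
have supp_v z : msupport tau z -> z%:E <= v.
  by move=> sz; apply: ereal_sup_ubound; exists z.
have Nu : tau.-negligible [set x | x%:E = u].
  apply/negligibleP; first exact: measurable_EFin_eq.
  case: tu => [->|[]//]; rewrite (_ : mkset _ = set0) ?measure0//.
  by apply/seteqP; split.
have Nv : tau.-negligible [set x | x%:E = v].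
  apply/negligibleP; first exact: measurable_EFin_eq.
  case: tv => [->|[]//]; rewrite (_ : mkset _ = set0) ?measure0//.
  by apply/seteqP; split.
have NS := negligible_msupportC tau.
have finI x y : I x -> I y -> tau `[x, y[%classic < +oo.
  move=> /andP[ux _] /andP[_ yv].
  have [px /andP[uw wx]] := ereal_between ux.
  have [xy|yx] := ltP x y; last first.
    by rewrite set_itv_ge ?measure0 ?ltry// bnd_simp -leNgt.
  apply: (@le_lt_trans _ _ (tau `]px, y[%classic)).
    apply: le_measure; rewrite ?inE; [exact: measurable_itv..|].
    move=> t; rewrite /= !in_itv/= => /andP[xt ->].
    by rewrite andbT (lt_le_trans _ xt).
  by apply: tfin => //; rewrite (lt_trans _ xy).
(* A support point outside I is one of its endpoints. *)
have tauIC : tau (~` I) = 0.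
  apply/negligibleP; first by apply: measurableC; exact: measurable_eoo.
  apply: negligibleS (negligibleU NS (negligibleU Nu Nv)) => z nIz.
  have [sz|] := pselect (msupport tau z); last by left.
  right.
  move: (supp_u z sz); rewrite le_eqVlt => /predU1P[uz|uz]; first by left.
  move: (supp_v z sz); rewrite le_eqVlt => /predU1P[zv|zv]; first by right.
  by exfalso; apply: nIz; rewrite /I /eoo /= uz.
have [H HE] := exists_distribution uv finI.
have H_ni x y : I x -> I y -> (x <= y)%R -> (H y <= H x)%R.
  by move=> Ix Iy xy; rewrite -subr_ge0 -lee_fin -HE// measure_ge0.
have H_left x s : I x ->
    (forall y, I y -> (y < x)%R -> (s <= H y)%R) -> (s <= H x)%R.
  move=> Ix sH; rewrite leNgt; apply/negP => Hs.
  have /andP[/ereal_between[p /andP[up px]] xv] := Ix.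
  have Ip : I p by rewrite /I /eoo /= up (lt_trans px).
  have [||y /andP[py yx]] := measure_co_small _ (finI p x Ip Ix) (e := s - H x).
  - by rewrite -lte_fin.
  - by rewrite subr_gt0.
  have Iy : I y by apply: (eoo_interval Ip Ix); rewrite py ltW.
  rewrite HE ?(ltW yx)// lte_fin ltrD2r ltNge => /negP; apply; exact: sH.
have tau_lt x y : I x -> I y -> (x < y)%R ->
    (H y < H x)%R <-> 0 < tau `[x, y[%classic.
  by move=> Ix Iy xy; rewrite HE ?(ltW xy)// lte_fin subr_gt0.
(* If H were constant to the right of x, the ray beyond x would have no support
   point but v, hence be null, against v being the supremum of the support. *)
have H_lt_right x : I x -> exists y, [/\ I y, (x < y)%R & (H y < H x)%R].
  move=> Ix; have /andP[ux xv] := Ix; apply: contrapT => nex.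
  have tau0 y : I y -> (x < y)%R -> tau `[x, y[%classic = 0.
    move=> Iy xy; apply/eqP; rewrite eq_le measure_ge0 andbT leNgt; apply/negP.
    by move=> /(tau_lt _ _ Ix Iy xy) Hyx; apply: nex; exists y.
  have tauray : tau `]x, +oo[%classic = 0.
    apply/negligibleP; first exact: measurable_itv.
    apply: negligibleS (negligibleU NS Nv) => z.
    rewrite /= in_itv/= andbT => xz.
    have [sz|] := pselect (msupport tau z); last by left.
    right; move: (supp_v z sz); rewrite le_eqVlt => /predU1P[//|].
    move=> /ereal_between[y /andP[zy yv]]; exfalso.
    have xy : (x < y)%R by rewrite (lt_trans xz).
    have Iy : I y by rewrite /I /eoo /= yv (lt_trans ux).
    by have := msupport_itv_gt0 sz xz zy; rewrite tau0// ltxx.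
  move: xv => /ereal_sup_gt[_ [z sz <-]]; rewrite lte_fin => xz.
  have := sz `]x, +oo[%classic (rray_open x); rewrite tauray ltxx.
  by rewrite /= in_itv/= andbT => /(_ xz).
have H_lt_left y : I y -> exists x, [/\ I x, (x < y)%R & (H y < H x)%R].
  move=> Iy; have /andP[uy yv] := Iy; apply: contrapT => nex.
  have tau0 x : I x -> (x < y)%R -> tau `[x, y[%classic = 0.
    move=> Ix xy; apply/eqP; rewrite eq_le measure_ge0 andbT leNgt; apply/negP.
    by move=> /(tau_lt _ _ Ix Iy xy) Hyx; apply: nex; exists x.
  have tauray : tau `]-oo, y[%classic = 0.
    apply/negligibleP; first exact: measurable_itv.
    apply: negligibleS (negligibleU NS Nu) => z; rewrite /= in_itv/= => zy.
    have [sz|] := pselect (msupport tau z); last by left.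
    right; move: (supp_u z sz); rewrite le_eqVlt => /predU1P[//|].
    move=> /ereal_between[x /andP[ux xz]]; exfalso.
    have xy : (x < y)%R by rewrite (lt_trans _ zy).
    have Ix : I x by rewrite /I /eoo /= ux (lt_trans _ yv).
    by have := msupport_itv_gt0 sz xz zy; rewrite tau0// ltxx.
  move: uy => /ereal_inf_lt[_ [z sz <-]]; rewrite lte_fin => zy.
  have := sz `]-oo, y[%classic (lray_open y); rewrite tauray ltxx.
  by rewrite /= in_itv/= => /(_ zy).
set a := ereal_inf [set (H x)%:E | x in I].
set b := ereal_sup [set (H x)%:E | x in I].
exists a, b, (generalized_inverse u v H).
split.
- have [x Ix] := ereal_between uv.
  have /andP[] : eoo a b (H x) by exact: generalized_inverse_dom.
  exact: lt_trans.
- exact: generalized_inverse_condition_A.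
have mf : measurable_fun (eoo a b) (generalized_inverse u v H).
  apply: nonincreasing_on_measurable; first exact: eoo_interval.
  exact: generalized_inverse_ni.
exists mf; apply: (@eq_measure_eoo _ u v) => //.
- rewrite /= tau_measureE; last by apply: measurableC; exact: measurable_eoo.
  rewrite (_ : _ `&` _ = set0) ?measure0//.
  apply/seteqP; split=> // s [Ds]; apply.
  by have [] := @generalized_inverse_galois _ _ _ _ H_ni H_left _ Ds.
- move=> x y Ix Iy xy; split; first exact: finI.
  rewrite /= tau_measureE; last exact: measurable_itv.
  rewrite generalized_inverse_preimage// HE// lebesgue_measure_itv/= lte_fin.
  have := H_ni _ _ Ix Iy xy; rewrite le_eqVlt => /predU1P[->|Hyx].
    by rewrite ltxx subrr.
  by rewrite Hyx EFinB.
Qed.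

Theorem theorem7p9 (R : realType) :
  (forall (a b : \bar R) (f : R -> R), a < b -> condition_A a b f ->
     exists mf : measurable_fun (eoo a b) f, condition_B (tau_measure mf))
  /\
  (forall tau : {measure set R -> \bar R}, condition_B tau ->
     exists (a b : \bar R) (f : R -> R),
       [/\ a < b, condition_A a b f
         & exists mf : measurable_fun (eoo a b) f,
             forall B : set R, measurable B -> tau B = tau_measure mf B]).
Proof.
split; first exact: condition_A_condition_B.
exact: condition_B_condition_A.
Qed.
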